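(* Let $G=(V,E)$ be an infinite, connected, locally finite, vertex-transitive graph. Let $(s(x))_{x\in V}$ be independent and identically distributed real random variables with $\mathbb{E}\, s(x)=1$ and $0<\operatorname{Var} s(x)<\infty$. Then almost surely the divisible sandpile $s$ does not stabilize.
   Context: Graphs are connected, locally finite and undirected; $x\sim y$ means $x,y$ are adjacent and $\deg(x)$ is the number of neighbours of $x$. The graph Laplacian is $\Delta u(x)=\sum_{y\sim x}(u(y)-u(x))$. A divisible sandpile is a function $s:V\to\mathbb{R}$. Let $\mathcal{F}_s=\{f:V\to\mathbb{R} \,:\, f\ge 0 \text{ and } s+\Delta f\le 1 \text{ pointwise}\}$. The sandpile $s$ is said to stabilize if $\mathcal{F}_s\neq\emptyset$ (equivalently, there is a finite toppling procedure after which every site has mass $\le 1$, where a site with mass $>1$ topples by keeping mass $1$ and distributing the excess equally among its neighbours). *)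

(* Defs.v *)
From HB Require Import structures.
From mathcomp Require Import all_boot all_order all_algebra.
From mathcomp Require Import all_classical all_reals all_analysis.
From Stdlib Require Import Relations.Relation_Operators.
Set Implicit Arguments. Unset Strict Implicit. Unset Printing Implicit Defensive.
Import Order.TTheory GRing.Theory Num.Theory.
Local Open Scope classical_set_scope.
Local Open Scope ring_scope.

(** A locally finite graph on vertex type [V] is given by its neighbour
    lists [nb x] (finite, duplicate-free); [x ~ y] iff [y \in nb x]. *)
Section Graph.
Variable V : eqType.
Variable nb : V -> seq V.

Definition adj (x y : V) : Prop := y \in nb x.

Definition is_lf_graph : Prop :=
  (forall x, uniq (nb x)) /\
  (forall x y, adj x y -> adj y x) /\
  (forall x, ~ adj x x).

Definition graph_connected : Prop :=
  forall x y, clos_refl_trans V adj x y.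

Definition graph_infinite : Prop :=
  ~ exists s : seq V, forall x, x \in s.

Definition automorphism (f : V -> V) : Prop :=
  bijective f /\ forall x y, adj x y <-> adj (f x) (f y).

Definition vertex_transitive : Prop :=
  forall x y, exists f, automorphism f /\ f x = y.

Variable R : realType.

Definition laplacian (u : V -> R) (x : V) : R :=
  \sum_(y <- nb x) (u y - u x).

Definition stab_set (s : V -> R) : set (V -> R) :=
  [set f | (forall x, 0 <= f x) /\ (forall x, s x + laplacian f x <= 1)].

Definition stabilizes (s : V -> R) : Prop := stab_set s !=set0.
End Graph.

Definition mutually_independent {d} {T : measurableType d} {R : realType}
  (P : probability T R) (I : eqType) (X : I -> T -> R) : Prop :=
  forall (J : seq I) (B : I -> set R),
    uniq J -> (forall i, measurable (B i)) ->
    P (\bigcap_(i in [set` J]) (X i @^-1` B i)) =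
    (\prod_(i <- J) P (X i @^-1` B i))%E.

Definition identically_distributed {d} {T : measurableType d} {R : realType}
  (P : probability T R) (I : Type) (X : I -> T -> R) : Prop :=
  forall i j (B : set R), measurable B ->
    P (X i @^-1` B) = P (X j @^-1` B).

(* Main.v *)
Require Import Defs.
From HB Require Import structures.
From mathcomp Require Import all_boot all_order all_algebra.
From mathcomp Require Import all_classical all_reals all_analysis.
From mathcomp Require Import measurable_realfun ring lra.
Set Implicit Arguments. Unset Strict Implicit. Unset Printing Implicit Defensive.
Import Order.TTheory GRing.Theory Num.Theory.
Local Open Scope classical_set_scope.
Local Open Scope ring_scope.

(** Let [D] be the degree, [xi = (s - 1) / D], and let [avg] be the transition
    operator of simple random walk, so that [f] stabilizes [s] iff [f >= 0] and
    [xi + avg f <= f]. The iterates [odo xi n] of [u |-> max 0 (xi + avg u)]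
    increase to the least such [f], so stabilization is the event [A] that they
    stay bounded.

    On an infinite graph the Cesaro means of the random walk spread out, hence
    [green m xi = xi + avg xi + ... + avg^(m-1) xi] has second moment [o(m^2)].

    By stationarity, the defects [odo xi n.+1 - xi - avg (odo xi n)], which
    decrease in [n], have on [A] an average expectation over [n < N] equal to
    [E(odo xi N; A) / N], which tends to [0]. Thus on [A] the least [f]
    satisfies [f = xi + avg f].

    Choose [e > 0] such that [xi o <= - e] has positive probability. By
    independence the same equality holds for the configuration [xi'] obtained
    from [xi] by replacing its values in a ball by their minimum with [- e].
    Subtracting the two equations, [f o >= green m (xi - xi') o >=
    green m xi o + m e] on [A] for all [m], and the right-hand side tends to
    infinity in probability. Hence [A] is negligible. *)

(** * The averaging operator, its Green sums and the toppling iteration *)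

Section Operators.
Context (V : eqType) (nb : V -> seq V) (R : realType).
Implicit Types (u v xi eta : V -> R) (x y z : V).

Definition avg u x : R := (\sum_(y <- nb x) u y) / (size (nb x))%:R.

(* [green m xi] is the sum of the first [m] iterates of [avg] applied to [xi]. *)
Fixpoint green m xi x : R :=
  if m is m'.+1 then xi x + avg (green m' xi) x else 0.

(* [odo xi n] increases with [n] to the least nonnegative [f] such that
   [xi + avg f <= f], if there is one. *)
Fixpoint odo xi n x : R :=
  if n is n'.+1 then Num.max 0 (xi x + avg (odo xi n') x) else 0.

Definition defect xi n x : R := odo xi n.+1 x - xi x - avg (odo xi n) x.

(** The sites that [green m] reads at [x]: those within distance [m - 1], listed with repetitions,
    and none for [m = 0]. *)
Fixpoint ball m x : seq V :=
  if m is m'.+1 then x :: flatten [seq ball m' y | y <- nb x] else [::].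

Definition point_mass y : V -> R := fun x => (x == y)%:R.

Lemma eq_avg u v x : u =1 v -> avg u x = avg v x.
Proof. by move=> uv; rewrite /avg; under eq_bigr do rewrite uv. Qed.

Lemma avg_le u v x : (forall y, y \in nb x -> u y <= v y) -> avg u x <= avg v x.
Proof.
move=> uv; rewrite /avg ler_wpM2r ?invr_ge0// big_seq [leRHS]big_seq.
exact: ler_sum.
Qed.

Lemma avg_sum (I : Type) (r : seq I) (F : I -> V -> R) x :
  avg (fun y => \sum_(i <- r) F i y) x = \sum_(i <- r) avg (F i) x.
Proof. by rewrite /avg exchange_big/= mulr_suml. Qed.

Lemma avgZ c u x : avg (fun y => c * u y) x = c * avg u x.
Proof. by rewrite /avg -mulr_sumr mulrA. Qed.

Lemma avgD u v x : avg (fun y => u y + v y) x = avg u x + avg v x.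
Proof. by rewrite /avg big_split mulrDl. Qed.

Lemma avg_ge0 u x : (forall y, 0 <= u y) -> 0 <= avg u x.
Proof. by move=> u0; rewrite mulr_ge0 ?invr_ge0// sumr_ge0. Qed.

Lemma eq_green m xi eta x : xi =1 eta -> green m xi x = green m eta x.
Proof.
move=> xe; elim: m x => //= m IH x.
by rewrite xe; congr (_ + _); apply: eq_avg.
Qed.

Lemma greenZ m c xi x : green m (fun y => c * xi y) x = c * green m xi x.
Proof.
elim: m x => [|m IH] x /=; first by rewrite mulr0.
by rewrite mulrDr -avgZ; congr (_ + _); apply: eq_avg.
Qed.

Lemma greenD m xi eta x :
  green m (fun y => xi y + eta y) x = green m xi x + green m eta x.
Proof.
elim: m x => [|m IH] x /=; first by rewrite addr0.
by rewrite addrACA -avgD; congr (_ + _); apply: eq_avg.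
Qed.

Lemma green_sum (I : Type) (r : seq I) (F : I -> V -> R) m x :
  green m (fun y => \sum_(i <- r) F i y) x = \sum_(i <- r) green m (F i) x.
Proof.
elim: m x => [|m IH] x /=; first by rewrite big1.
by rewrite big_split/= -avg_sum; congr (_ + _); apply: eq_avg.
Qed.

Lemma green_le m xi eta x : (forall y, y \in ball m x -> xi y <= eta y) ->
  green m xi x <= green m eta x.
Proof.
elim: m x => //= m IH x xe; apply: lerD; first by apply: xe; rewrite inE eqxx.
apply: avg_le => y yx; apply: IH => z zy; apply: xe.
rewrite inE; apply/orP; right; apply/flattenP; exists (ball m y) => //.
exact: map_f.
Qed.

Lemma green_ge0 m xi x : (forall y, 0 <= xi y) -> 0 <= green m xi x.
Proof.
move=> xi0; elim: m x => //= m IH x.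
by apply: addr_ge0 => //; exact: avg_ge0.
Qed.

Lemma green_leS m xi x : (forall y, 0 <= xi y) -> green m xi x <= green m.+1 xi x.
Proof.
move=> xi0; elim: m x => [|m IH] x; first exact: (@green_ge0 1).
by rewrite [leLHS]/= [leRHS]/= lerD2l; apply: avg_le => y _; exact: IH.
Qed.

Lemma odo_ge0 xi n x : 0 <= odo xi n x.
Proof. by case: n => //= n; rewrite le_max lexx. Qed.

Lemma odo_leS xi n x : odo xi n x <= odo xi n.+1 x.
Proof.
elim: n x => [|n IH] x; first exact: odo_ge0.
rewrite [leLHS]/= [leRHS]/= ge_max le_max lexx /= le_max; apply/orP; right.
by rewrite lerD2l; apply: avg_le => y _; exact: IH.
Qed.

Lemma odo_homo xi x : {homo (fun n => odo xi n x) : n m / (n <= m)%N >-> n <= m}.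
Proof. by apply: homo_leq => //; [exact: le_trans | move=> n; exact: odo_leS]. Qed.

Lemma odo_le xi eta n x : (forall y, xi y <= eta y) -> odo xi n x <= odo eta n x.
Proof.
move=> xe; elim: n x => //= n IH x.
rewrite ge_max !le_max lexx/=; apply/orP; right.
by apply: lerD => //; apply: avg_le.
Qed.

Lemma odo_least xi f n x : (forall y, 0 <= f y) ->
  (forall y, xi y + avg f y <= f y) -> odo xi n x <= f x.
Proof.
move=> f0 xf; elim: n x => //= n IH x; rewrite ge_max f0/=.
by apply: le_trans (xf x); rewrite lerD2l; apply: avg_le.
Qed.

Lemma odo_green xi n x : odo xi n x <= green n (fun y => `|xi y|) x.
Proof.
elim: n x => //= n IH x; rewrite ge_max; apply/andP; split.
  by apply: (@green_ge0 n.+1) => y.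
by apply: lerD; [exact: ler_norm | apply: avg_le].
Qed.

Lemma odoS_ge xi n x : xi x + avg (odo xi n) x <= odo xi n.+1 x.
Proof. by rewrite /= le_max lexx orbT. Qed.

Lemma defect_ge0 xi n x : 0 <= defect xi n x.
Proof. by rewrite /defect -addrA -opprD subr_ge0 odoS_ge. Qed.

Lemma defectE xi n x : defect xi n x = Num.max (- (xi x + avg (odo xi n) x)) 0.
Proof.
by rewrite /defect -addrA -opprD /= addr_maxl add0r subrr.
Qed.

(** By [defectE] the defect is the negative part of an expression that increases with both the
    configuration and the time. *)
Lemma defect_anti xi eta n m x : (forall y, xi y <= eta y) -> (n <= m)%N ->
  defect eta m x <= defect xi n x.
Proof.
move=> xe nm; rewrite !defectE ge_max !le_max lexx orbT andbT lerN2.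
apply/orP; left; apply: lerD => //; apply: avg_le => y _.
by apply: (le_trans (odo_le n y xe)); exact: odo_homo.
Qed.

(** Each step averages the gap between the two iterations and adds at least [xi - eta] minus the
    current defect of [eta]. Defects decrease, so from time [n] on the one at [n] bounds them
    all. *)
Lemma odo_gap xi eta n m x : (forall y, eta y <= xi y) ->
  green m (fun y => xi y - eta y - defect eta n y) x
    <= odo xi (n + m) x - odo eta (n + m) x.
Proof.
move=> ex; elim: m x => [|m IH] x; first by rewrite addn0 subr_ge0; exact: odo_le.
rewrite addnS [leLHS]/=.
have h1 := odoS_ge xi (n + m) x.
have h2 : odo eta (n + m).+1 x =
    eta x + avg (odo eta (n + m)) x + defect eta (n + m) x.
  by rewrite /defect; ring.
have h3 : defect eta (n + m) x <= defect eta n x.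
  by apply: defect_anti => //; exact: leq_addr.
have h4 : avg (green m (fun y => xi y - eta y - defect eta n y)) x <=
    avg (odo xi (n + m)) x - avg (odo eta (n + m)) x.
  rewrite -[- avg _ _]mulN1r -avgZ -avgD; apply: avg_le => y _.
  by rewrite mulN1r; exact: IH.
by rewrite h2; lra.
Qed.

Definition nb_equivariant (phi : V -> V) :=
  forall x, perm_eq (map phi (nb x)) (nb (phi x)).

Lemma avg_automorphism phi u x : nb_equivariant phi ->
  avg (u \o phi) x = avg u (phi x).
Proof.
move=> aphi; rewrite /avg -(perm_size (aphi x)) size_map; congr (_ / _).
by rewrite -(perm_big _ (aphi x))/= big_map.
Qed.

Lemma odo_automorphism phi xi n x : nb_equivariant phi ->
  odo (xi \o phi) n x = odo xi n (phi x).
Proof.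
move=> aphi; elim: n x => //= n IH x; congr (Num.max _ (_ + _)).
by rewrite -avg_automorphism//; apply: eq_avg => y; exact: IH.
Qed.

End Operators.

(** * Green function of simple random walk on an infinite transitive graph *)

Section TransitiveGraph.
Context (V : eqType) (nb : V -> seq V) (R : realType).
Hypothesis nbG : is_lf_graph nb.
Hypothesis connG : graph_connected nb.
Hypothesis infG : graph_infinite V.
Hypothesis transG : vertex_transitive nb.
Implicit Types (u xi : V -> R) (x y z : V).

Lemma perm_nb_automorphism phi : automorphism nb phi -> nb_equivariant nb phi.
Proof.
move=> [[psi phiK psiK] aphi] x; case: nbG => nbu _; apply: uniq_perm => //.
  by rewrite map_inj_uniq//; exact: can_inj phiK.
move=> y; apply/mapP/idP => [[z zx ->]|yx]; first exact: (proj1 (aphi x z)).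
exists (psi y); rewrite ?psiK//; apply: (proj2 (aphi x (psi y))).
by rewrite /adj psiK.
Qed.

Lemma size_nb x y : size (nb x) = size (nb y).
Proof.
have [phi [/perm_nb_automorphism aphi <-]] := transG x y.
by rewrite -(perm_size (aphi x)) size_map.
Qed.

(** If no edge left [L], connectedness would put every vertex in [L]. *)
Lemma adj_exit (L : seq V) x : x \in L ->
  exists y z, [/\ y \in L, z \notin L & z \in nb y].
Proof.
move=> xL; apply: contrapT => noexit; apply: infG; exists L => z.
elim: {z}(connG x z) xL => [{}x z xz xL|//|{}x y z _ xy _ yz /xy/yz//].
by apply/negPn/negP => zL; apply: noexit; exists x, z.
Qed.

Lemma nb_gt0 x : (0 < size (nb x))%N.
Proof.
have [|y [z [_ _ zy]]] := @adj_exit [:: x] x; first by rewrite inE.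
by rewrite (size_nb x y); case: (nb y) zy.
Qed.

Lemma avg_cst c x : avg nb (fun=> c) x = c :> R.
Proof.
rewrite /avg big_const_seq count_predT iter_addr addr0 -[c *+ _]mulr_natr mulfK//.
by rewrite pnatr_eq0 -lt0n nb_gt0.
Qed.

Lemma green_cst m c x : green nb m (fun=> c) x = m%:R * c :> R.
Proof.
elim: m x => [|m IH] x /=; first by rewrite mul0r.
by rewrite (eq_avg nb x IH) avg_cst mulrSr addrC; ring.
Qed.

(** Both sides are one-step transition probabilities, from [y] to [x] and from [x] to [y]; they
    agree as adjacency is symmetric and the degree constant. *)
Lemma avg_point_mass x y :
  avg nb (point_mass R x) y =
  (\sum_(z <- nb x) point_mass R z y) / (size (nb x))%:R.
Proof.
case: nbG => nbu [nbs _]; rewrite /avg /point_mass (size_nb y x); congr (_ / _).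
have sE (a : V) r : uniq r -> \sum_(z <- r) (z == a)%:R = (a \in r)%:R :> R.
  elim: r => [|b r IH] /=; first by rewrite big_nil.
  case/andP => br /IH {}IH; rewrite big_cons IH inE eq_sym.
  by have [->|] := eqVneq a b; rewrite ?(negbTE br) ?addr0 ?add0r.
rewrite sE//; under eq_bigr do rewrite eq_sym.
by rewrite sE//; congr (_%:R); congr nat_of_bool; apply/idP/idP; exact: nbs.
Qed.

(** A step of the walk is peeled off at the start on one side and at the end on the other; [avg]
    commutes with [green m]. *)
Lemma green_sym m x y :
  green nb m (point_mass R y) x = green nb m (point_mass R x) y.
Proof.
elim: m x y => //= m IH x y; rewrite {1 2}/point_mass eq_sym; congr (_ + _).
have avgG u : avg nb (green nb m u) y = green nb m (avg nb u) y.
  elim: m {IH} y => [|k IHk] y /=.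
    exact: avg_cst.
  by rewrite avgD; congr (_ + _); apply: eq_avg.
rewrite avgG (eq_green nb _ _ (avg_point_mass x)).
under [RHS]eq_green do rewrite mulrC.
rewrite greenZ green_sum mulrC /avg; congr (_ / _).
by apply: eq_bigr => z _; exact: IH.
Qed.

(* If [g] is within [c] of its supremum at a point, near-harmonicity puts it
   within [D * (c + 1)] of the supremum at each of the [D] neighbours. *)
Fixpoint level_loss D N : R := if N is N'.+1 then D * (level_loss D N' + 1) else 1.

Lemma green_point_mass_bounded m x y : green nb m (point_mass R x) y <= m%:R.
Proof.
rewrite -[leRHS]mulr1 -(green_cst m 1 y); apply: green_le => z _.
by rewrite /point_mass; case: eqP.
Qed.

(* [N.+1] points where the Green function nears its supremum cannot carry more
   than its total mass [m]. *)
Lemma green_point_mass_le D N m x y : D = (size (nb x))%:R ->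
  green nb m (point_mass R x) y <= m%:R / N.+1%:R + level_loss D N.
Proof.
move=> DE; set g := green nb m (point_mass R x).
have D1 : 1 <= D by rewrite DE ler1n nb_gt0.
have hs : has_sup (range g).
  split; first by exists (g x), x.
  by exists m%:R => _ [z _ <-]; exact: green_point_mass_bounded.
set M := sup (range g).
have gM z : g z <= M by apply: sup_upper_bound => //; exists z.
have loss1 k : 1 <= level_loss D k.
  elim: k => //= k IH.
  have : 1 * 1 <= D * (level_loss D k + 1) by apply: ler_pM => //; lra.
  by rewrite mulr1.
(* One more term only raises [g], and [green m.+1] is the point mass, at most 1, plus [avg g]. *)
have gavg z : g z <= avg nb g z + 1.
  apply: le_trans (@green_leS _ nb R m (point_mass R x) z _) _.
    by move=> ?; rewrite /point_mass.
  by rewrite /= addrC lerD2l /point_mass; case: eqP.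
(* The other [D - 1] neighbours contribute at most [M] each, so an average of at least [M - (c + 1)]
   leaves at least [M - D * (c + 1)] for [z']. *)
have step c z z' : 0 <= c -> M - c <= g z -> z' \in nb z -> M - D * (c + 1) <= g z'.
  move=> c0 Mc zz'.
  have Dz : D = (size (nb z))%:R by rewrite DE (size_nb x z).
  have h : M - (c + 1) <= avg nb g z by have := gavg z; lra.
  have D0 : 0 < D by lra.
  move: h; rewrite /avg -Dz ler_pdivlMr// (perm_big _ (perm_to_rem zz'))/= big_cons.
  have : \sum_(t <- rem z' (nb z)) g t <= \sum_(t <- rem z' (nb z)) M.
    by apply: ler_sum => t _.
  rewrite big_const_seq count_predT iter_addr addr0 size_rem// -mulr_natr.
  have -> : (size (nb z)).-1%:R = D - 1.
    by rewrite Dz -[in RHS](prednK (nb_gt0 z)) mulrSr addrK.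
  by move: (c) (M) => ? ?; nra.
(* Start within 1 of the supremum and keep adding the far end of an edge that leaves the list. *)
have [L [uL sL gL]] : exists L, [/\ uniq L, size L = N.+1 &
    forall z, z \in L -> M - level_loss D N <= g z].
  elim: N => [|N [L [uL sL gL]]].
    have [_ [z _ <-] zM] := sup_adherent (@ltr01 R) hs.
    by exists [:: z]; split=> // t; rewrite inE => /eqP->; apply: ltW.
  have [z0 z0L] : exists z0, z0 \in L.
    by case: L sL {uL gL} => // a L _; exists a; rewrite inE eqxx.
  have [z [z' [zL z'L zz']]] := adj_exit z0L.
  have l0 : 0 <= level_loss D N by have := loss1 N; lra.
  exists (z' :: L); split=> [| |t]; rewrite /= ?z'L ?sL//.
  rewrite inE => /predU1P[->|tL]; first by apply: step zz' => //; exact: gL.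
  by have := gL t tL; move: l0 D1; move: (level_loss _ _) => l *; nra.
(* By symmetry this is the Green sum at [x] of the point masses on [L], whose total is at most 1
   everywhere since [L] has no repetitions. *)
have sumL : \sum_(z <- L) g z <= m%:R.
  rewrite /g; under eq_bigr do rewrite green_sym.
  rewrite -green_sum -[leRHS]mulr1 -(green_cst m 1 x); apply: green_le => t _.
  rewrite /point_mass; elim: L uL {sL gL} => [|a L IH] /=; first by rewrite big_nil.
  case/andP => aL uL; rewrite big_cons.
  have [ta|_] := eqVneq t a; last by rewrite add0r; exact: IH.
  rewrite big_seq big1 ?addr0// => b bL; case: eqP => // tb.
  by move: aL; rewrite -ta tb bL.
apply: le_trans (gM y) _; rewrite -lerBlDr ler_pdivlMr//.
apply: le_trans sumL.
have -> : (M - level_loss D N) * N.+1%:R = \sum_(z <- L) (M - level_loss D N).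
  by rewrite big_const_seq count_predT iter_addr addr0 sL mulr_natr.
by rewrite big_seq [leRHS]big_seq; apply: ler_sum => z zL; exact: gL.
Qed.

End TransitiveGraph.

(** * Independent identically distributed configurations *)

Section Configurations.
Context (V : eqType) (R : realType).
Implicit Types (J : seq V) (B : V -> set R) (xi : V -> R).

Definition real_config := V -> R.
HB.instance Definition _ := Choice.on real_config.
HB.instance Definition _ := isPointed.Build real_config (fun=> 0).

Definition cylinder J B : set real_config := [set xi | forall i, i \in J -> B i (xi i)].

Definition cylinders : set (set real_config) :=
  [set C | exists J B, (forall i, measurable (B i)) /\ C = cylinder J B].

Definition config := g_sigma_algebraType cylinders.

Lemma cylinder_nil B : cylinder [::] B = setT.
Proof. by apply/seteqP; split. Qed.

Lemma cylinder_undup J B : cylinder (undup J) B = cylinder J B.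
Proof.
by apply/seteqP; split=> xi h i iJ; apply: h; rewrite ?mem_undup// -mem_undup.
Qed.

Lemma measurable_cylinder J B : (forall i, measurable (B i)) ->
  measurable (cylinder J B : set config).
Proof. by move=> mB; apply: sub_sigma_algebra; exists J, B. Qed.

Lemma setI_closed_cylinders : setI_closed cylinders.
Proof.
move=> _ _ [J [B [mB ->]]] [J' [B' [mB' ->]]].
exists (J ++ J'), (fun i => (if i \in J then B i else setT) `&`
                            (if i \in J' then B' i else setT)); split.
  by move=> i; apply: measurableI; case: ifP.
apply/seteqP; split=> [xi [h h'] i _|xi h]; first by split; case: ifP => // /[dup]; auto.
split=> i iJ; have := h i; rewrite mem_cat iJ ?orbT => /(_ isT)[]//.
Qed.

Lemma measurable_coord (i : V) : measurable_fun setT (fun xi : config => xi i).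
Proof.
move=> _ A mA; rewrite setTI.
rewrite (_ : _ @^-1` _ = cylinder [:: i] (fun=> A)); first exact: measurable_cylinder.
apply/seteqP; split=> xi /=; first by move=> ? j; rewrite inE => /eqP->.
by apply; rewrite inE.
Qed.

Lemma measurable_to_config d (T : measurableType d) (F : T -> config) :
  (forall i, measurable_fun setT (fun t => F t i)) -> measurable_fun setT F.
Proof.
move=> mF; apply: (@measurability _ _ T config setT F cylinders erefl).
move=> _ [_ [J [B [mB ->]]] <-]; rewrite setTI.
rewrite (_ : _ @^-1` _ = \bigcap_(i in [set` J]) (fun t => F t i) @^-1` B i) //.
apply: fin_bigcap_measurable => // i _.
by rewrite -[X in measurable X]setTI; exact: mF.
Qed.

(** Cylinders form a pi-system, and [undup] reduces their index lists to the duplicate-free ones of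
    product formulas. *)
Lemma eq_measure_config (m1 m2 : {measure set config -> \bar R}) :
  (forall J B, uniq J -> (forall i, measurable (B i)) ->
     m1 (cylinder J B) = m2 (cylinder J B)) ->
  (m1 setT < +oo)%E -> forall E, measurable E -> m1 E = m2 E.
Proof.
move=> m12 m1oo E mE.
apply: (@measure_unique _ _ config cylinders (fun=> setT) erefl) => //.
- exact: setI_closed_cylinders.
- by move=> _; exists [::], (fun=> setT); rewrite cylinder_nil.
- by rewrite bigcup_const//; exists 0%N.
- move=> _ [J [B [mB ->]]]; rewrite -cylinder_undup; apply: m12 => //.
  exact: undup_uniq.
Qed.

(** One-point lists identify [nu] on measurable sets with every marginal, so independence and
    equality of laws are expressed at once. *)
Definition iid_law (mu : set config -> \bar R) : Prop := exists nu : set R -> \bar R,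
  forall J B, uniq J -> (forall i, measurable (B i)) ->
    mu (cylinder J B) = (\prod_(i <- J) nu (B i))%E.

Context (mu : probability config R).
Hypothesis iid_mu : iid_law mu.

Lemma iid_cylinder i0 J B : uniq J -> (forall i, measurable (B i)) ->
  mu (cylinder J B) = (\prod_(i <- J) mu [set xi | B i (xi i0)])%E.
Proof.
move=> uJ mB; have [nu hnu] := iid_mu; rewrite hnu//; apply: eq_bigr => i _.
have := hnu [:: i0] (fun=> B i) isT (fun=> mB i); rewrite big_seq1 => <-.
congr (mu _); apply/seteqP; split=> xi /=; first by apply; rewrite inE.
by move=> ? j; rewrite inE => /eqP->.
Qed.

Lemma iid_marginal i j (A : set R) : measurable A ->
  mu [set xi | A (xi i)] = mu [set xi | A (xi j)].
Proof.
move=> mA; have := @iid_cylinder i [:: i] (fun=> A) isT (fun=> mA).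
by rewrite (iid_cylinder j)// !big_seq1.
Qed.

Lemma iid_cylinder_gt0 i0 J (A : set R) : measurable A ->
  (0 < mu [set xi | A (xi i0)])%E -> (0 < mu (cylinder J (fun=> A)))%E.
Proof.
move=> mA A0; rewrite -cylinder_undup (iid_cylinder i0) ?undup_uniq//.
by elim/big_ind : _ => // ? ? ? ?; exact: mule_gt0.
Qed.

Definition reindex (phi : V -> V) : config -> config := fun xi => xi \o phi.

Lemma measurable_reindex phi : measurable_fun setT (reindex phi).
Proof. by apply: measurable_to_config => i; exact: measurable_coord. Qed.

HB.instance Definition _ phi :=
  isMeasurableFun.Build _ _ _ _ (reindex phi) (measurable_reindex phi).

(** The preimage of a cylinder is a cylinder over the permuted sites with the same factors. *)
Lemma iid_reindex phi E : bijective phi -> measurable E ->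
  mu (reindex phi @^-1` E) = mu E.
Proof.
move=> [psi phiK psiK] mE; have [nu hnu] := iid_mu.
apply: (@eq_measure_config (distribution mu (reindex phi)) mu _ _ E mE).
  move=> J B uJ mB; change (mu (reindex phi @^-1` cylinder J B) = mu (cylinder J B)).
  rewrite (_ : _ @^-1` _ = cylinder (map phi J) (B \o psi)).
    rewrite !hnu//; last 2 first.
    - by rewrite map_inj_uniq//; exact: can_inj phiK.
    - by move=> i; exact: mB.
    by rewrite big_map; under eq_bigr do rewrite /= phiK.
  apply/seteqP; split=> xi h i.
    by move=> /mapP[j jJ ->]; rewrite /= phiK; exact: h.
  by move=> iJ; have := h (phi i); rewrite /= phiK; apply; exact: map_f.
by apply: le_lt_trans (ltry 1); exact: (probability_le1 (distribution mu _)).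
Qed.

Definition overwrite (F : seq V) (a : R) : config -> config :=
  fun xi i => if i \in F then a else xi i.

Lemma measurable_overwrite F a : measurable_fun setT (overwrite F a).
Proof.
apply: measurable_to_config => i; rewrite /overwrite.
by case: (i \in F); [exact: measurable_cst|exact: measurable_coord].
Qed.

HB.instance Definition _ F a :=
  isMeasurableFun.Build _ _ _ _ (overwrite F a) (measurable_overwrite F a).

(** The overwritten configuration depends only on the sites outside [F], hence is independent of the
    values on [F]. Both sides are finite measures in [E], compared on cylinders. *)
Lemma iid_overwrite F a B E : (forall i, measurable (B i)) -> measurable E ->
  mu (overwrite F a @^-1` E `&` cylinder F B) =
  (mu (cylinder F B) * mu (overwrite F a @^-1` E))%E.
Proof.
move=> mB mE; have [nu hnu] := iid_mu; rewrite -cylinder_undup.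
set C := cylinder _ _.
have mC : measurable (C : set config) by exact: measurable_cylinder.
have C0 : 0 <= fine (mu C) by rewrite fine_ge0.
pose restricted : {measure set config -> \bar R} :=
  pushforward (mrestr mu mC) (overwrite F a).
pose m1 := restricted (measurable_overwrite F a).
pose m2 : {measure set config -> \bar R} :=
  mscale (NngNum C0) (distribution mu (overwrite F a)).
suff -> : mu (overwrite F a @^-1` E `&` C) = m2 E.
  by rewrite /m2 /= /mscale/= fineK// fin_num_measure.
change (m1 E = m2 E).
apply: (@eq_measure_config m1 m2) mE; last first.
  apply: le_lt_trans (ltry 1).
  change (mu (overwrite F a @^-1` setT `&` C) <= 1%:E)%E.
  by rewrite preimage_setT setTI; exact: probability_le1.
move=> J B' uJ mB'; rewrite /m2/= /mscale/= fineK ?fin_num_measure//.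
change (mu (overwrite F a @^-1` cylinder J B' `&` C) =
  (mu C * mu (overwrite F a @^-1` cylinder J B'))%E).
(* A cylinder that excludes [a] at a site of [F] has empty preimage; otherwise only its constraints
   outside [F] remain. *)
have [ok|nok] := pselect (forall i, i \in J -> i \in F -> B' i a); last first.
  rewrite (_ : overwrite F a @^-1` _ = set0) ?set0I ?measure0 ?mule0//.
  apply/seteqP; split=> // xi h; apply: nok => i iJ iF.
  by have := h i iJ; rewrite /overwrite iF.
pose J' := [seq i <- J | i \notin F].
rewrite (_ : overwrite F a @^-1` _ = cylinder J' B'); last first.
  apply/seteqP; split=> xi h i.
    by rewrite mem_filter => /andP[/negbTE iF /h]; rewrite /overwrite iF.
  rewrite /overwrite; case: ifPn => [iF iJ|iF iJ]; first exact: ok.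
  by apply: h; rewrite mem_filter iF.
pose B'' i := if i \in F then B i else B' i.
rewrite (_ : _ `&` _ = cylinder (undup F ++ J') B''); last first.
  apply/seteqP; split=> [xi [h h'] i|xi h].
    rewrite mem_cat /B''; case: ifPn => [iF _|iF /orP[|]].
    - by apply: h'; rewrite mem_undup.
    - by rewrite mem_undup (negbTE iF).
    - exact: h.
  split=> i iJ; have := h i; rewrite mem_cat iJ ?orbT /B'' => /(_ isT).
    by move: iJ; rewrite mem_filter => /andP[/negbTE->].
  by move: iJ; rewrite mem_undup => ->.
rewrite !hnu ?undup_uniq ?filter_uniq//.
- rewrite big_cat/=; congr (_ * _)%E; rewrite big_seq [RHS]big_seq.
    by apply: eq_bigr => i; rewrite mem_undup /B'' => ->.
  by apply: eq_bigr => i; rewrite mem_filter /B'' => /andP[/negbTE->].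
- rewrite cat_uniq undup_uniq filter_uniq//= andbT -all_predC.
  by apply/allP => i /=; rewrite mem_filter mem_undup => /andP[].
- by move=> i; rewrite /B''; case: ifP.
Qed.

End Configurations.

(** * Expectations of real random variables *)

Section RealIntegrals.
Context d (T : measurableType d) (R : realType) (mu : probability T R).
Implicit Types (f g : T -> R).
Local Notation integrableR f := (mu.-integrable setT (EFin \o f)).

Lemma integrableRD f g : integrableR f -> integrableR g ->
  integrableR (fun t => f t + g t).
Proof. exact: integrableD. Qed.

Lemma integrableRZ c f : integrableR f -> integrableR (fun t => c * f t).
Proof. exact: integrableZl. Qed.

Lemma integrableR_cst c : integrableR (fun=> c).
Proof. exact: finite_measure_integrable_cst. Qed.

Lemma integrableR_sum (I : Type) (r : seq I) (F : I -> T -> R) :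
  (forall i, integrableR (F i)) -> integrableR (fun t => \sum_(i <- r) F i t).
Proof.
move=> iF; elim: r => [|a r IH].
  by under eq_fun do rewrite big_nil; exact: integrableR_cst.
by under eq_fun do rewrite big_cons; exact: integrableRD.
Qed.

Lemma integrableR_measurable f : integrableR f -> measurable_fun setT f.
Proof. by case/integrableP => /measurable_EFinP. Qed.

Lemma integrableR_le f g : measurable_fun setT f -> integrableR g ->
  (forall t, `|f t| <= g t) -> integrableR f.
Proof.
move=> mf ig fg; apply: le_integrable ig => //; first exact/measurable_EFinP.
by move=> t _; rewrite /= lee_fin (le_trans (fg t))// ler_norm.
Qed.

Lemma integrableR_norm f : integrableR f -> integrableR (fun t => `|f t|).
Proof. exact: integrable_norm. Qed.

Lemma integrableR_indic f A : measurable A -> integrableR f ->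
  integrableR (fun t => f t * \1_A t).
Proof.
move=> mA jf; apply: (integrableR_le _ (integrableR_norm jf)) => [|t].
  by apply: measurable_funM; [exact: integrableR_measurable|exact: measurable_indic].
by rewrite normrM indicE; case: (_ \in _); rewrite ?normr1 ?normr0 ?mulr1 ?mulr0.
Qed.

Lemma integrableR_mul f g : measurable_fun setT f -> measurable_fun setT g ->
  integrableR (fun t => f t ^+ 2) -> integrableR (fun t => g t ^+ 2) ->
  integrableR (fun t => f t * g t).
Proof.
move=> mf mg f2 g2; apply: (integrableR_le _ (integrableRD f2 g2)) => [|t].
  exact: measurable_funM.
rewrite ler_norml; have h := sqr_ge0 (f t - g t); have h' := sqr_ge0 (f t + g t).
have hf := sqr_ge0 (f t); have hg := sqr_ge0 (g t).
move: h h' hf hg; rewrite !expr2; move: (f t) (g t) => a b *.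
by apply/andP; split; nra.
Qed.

Lemma integrableR_sqrt f : measurable_fun setT f ->
  integrableR (fun t => f t ^+ 2) -> integrableR f.
Proof.
move=> mf f2; apply: (integrableR_le mf (integrableRD (integrableR_cst 1) f2)) => t.
have := sqr_ge0 (`|f t| - 1); have := sqr_ge0 `|f t|.
by rewrite -(real_normK (num_real (f t))) !expr2; move: `|f t| => a *; nra.
Qed.

Lemma Rintegral_prob_cst c : \int[mu]_(_ in setT) c = c.
Proof.
rewrite Rintegral_cst// -[RHS]mulr1; congr (_ * _).
exact: (congr1 fine (probability_setT mu)).
Qed.

Lemma Rintegral_sum (I : Type) (r : seq I) (F : I -> T -> R) :
  (forall i, integrableR (F i)) ->
  \int[mu]_t (\sum_(i <- r) F i t) = \sum_(i <- r) \int[mu]_t F i t.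
Proof.
move=> iF; elim: r => [|a r IH].
  under eq_Rintegral do rewrite big_nil.
  by rewrite big_nil Rintegral_prob_cst.
under eq_Rintegral do rewrite big_cons.
by rewrite RintegralD ?IH ?big_cons//; exact: integrableR_sum.
Qed.

Lemma Rintegral_indic A : measurable A -> \int[mu]_t \1_A t = fine (mu A).
Proof. by move=> mA; rewrite /Rintegral integral_indic// setIT. Qed.

Lemma RintegralcM_indic c A : measurable A ->
  \int[mu]_t (c * \1_A t) = c * fine (mu A).
Proof.
move=> mA; rewrite RintegralZl ?Rintegral_indic//.
by have := integrableR_indic mA (integrableR_cst 1); under eq_fun do rewrite mul1r.
Qed.

(** Continuity from above along differences that decrease to the empty set. *)
Lemma mu_bigcup_tail (F : (set T)^nat) (e : R) : 0 < e ->
  (forall k, measurable (F k)) -> nondecreasing_seq F ->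
  exists k, fine (mu (\bigcup_n F n `\` F k)) <= e.
Proof.
move=> e0 mF ndF; pose D k := \bigcup_n F n `\` F k.
have mD k : measurable (D k).
  by apply: measurableD => //; exact: bigcupT_measurable.
have D0 : \bigcap_k D k = set0.
  by apply/seteqP; split=> // t Dt; have [[k _ Fk] _] := Dt 0%N I; have [] := Dt k I.
have niD : nonincreasing_seq D.
  move=> n m nm; apply/subsetPset => t [? nF]; split=> // Fn; apply: nF.
  by have /subsetPset/(_ t Fn) := ndF _ _ nm.
have D0oo : (mu (D 0%N) < +oo)%E by rewrite ltey_eq fin_num_measure.
have := @nonincreasing_cvg_mu _ _ _ mu D D0oo mD _ niD.
rewrite D0 measure0 => /(_ measurable0)/fine_cvgP[_ /cvgrPdist_le/(_ e e0)[k _ ek]].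
exists k; have := ek k (leqnn k); rewrite sub0r normrN.
exact: le_trans (ler_norm _).
Qed.

(** Otherwise [f] is nonnegative almost everywhere, hence zero almost everywhere as its integral
    vanishes, against the positive second moment. *)
Lemma neg_level_gt0 f : integrableR f -> \int[mu]_t f t = 0 ->
  0 < \int[mu]_t (f t ^+ 2) ->
  exists2 e : R, 0 < e & (0 < mu [set t | (f t <= - e)%R])%E.
Proof.
move=> jf f0 f2; apply: contrapT => nolevel.
have mf := integrableR_measurable jf.
have mlevel (e : R) : measurable [set t | (f t <= e)%R].
  rewrite -[X in measurable X]setTI (_ : [set t | _] = f @^-1` `]-oo, e]).
    by apply: mf => //; exact: measurable_itv.
  by apply/seteqP; split=> t /=; rewrite in_itv.
have [N [mN N0 sN]] : mu.-negligible (\bigcup_k [set t | f t <= - k.+1%:R^-1]).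
  apply: negligible_bigcup => k; exists [set t | f t <= - k.+1%:R^-1].
  split=> //; apply/eqP; rewrite eq_le measure_ge0 andbT leNgt; apply/negP => h.
  by apply: nolevel; exists k.+1%:R^-1 => //; rewrite invr_gt0.
have fge0 : {ae mu, forall t, 0 <= f t}.
  exists N; split=> // t /= /negP; rewrite -ltNge => ft; apply: sN.
  exists (Num.trunc (- f t)^-1) => //=; rewrite lerNr.
  rewrite -[leRHS]invrK lef_pV2 ?posrE ?invr_gt0 ?oppr_gt0//.
  exact/ltW/truncnS_gt.
have mfE : measurable_fun setT (EFin \o f) by exact/measurable_EFinP.
have f_ae0 : ae_eq mu setT (EFin \o f) (cst 0%E).
  apply/(ae_eq_integral_abs mu measurableT mfE).
  transitivity (\int[mu]_t (f t)%:E)%E.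
    apply: ae_eq_integral => //; first exact: measurableT_comp.
    by apply: filterS fge0 => t ft _ /=; rewrite ger0_norm.
  transitivity (\int[mu]_t f t)%:E; last by rewrite f0.
  exact/esym/fineK/integrable_fin_num.
suff : \int[mu]_t (f t ^+ 2) = 0 by move=> h; move: f2; rewrite h ltxx.
rewrite /Rintegral (ae_eq_integral (cst 0%E))//; first by rewrite integral0.
  by apply/measurable_EFinP; exact: measurable_funX.
by apply: filterS f_ae0 => t /(_ I) [->] _; rewrite expr0n.
Qed.

End RealIntegrals.

(** * Vanishing covariance of independent coordinates *)

Section IidMoments.
Context (V : eqType) (R : realType) (mu : probability (config V R) R).
Hypothesis iid_mu : iid_law mu.

Definition coord (i : V) : config V R -> R := fun xi => xi i.

HB.instance Definition _ i :=
  isMeasurableFun.Build _ _ _ _ (coord i) (measurable_coord i).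

(** The joint law of the two coordinates is the product of the marginals, and by Fubini's theorem
    the inner integral is a multiple of the mean of [coord j]. *)
Lemma iid_uncorrelated i j : i != j ->
  mu.-integrable setT (fun xi => (coord i xi * coord j xi)%:E) ->
  mu.-integrable setT (EFin \o coord j) ->
  \int[mu]_xi coord j xi = 0 -> \int[mu]_xi (coord i xi * coord j xi) = 0.
Proof.
move=> ij iij ij1 mj0.
pose pr (xi : config V R) := (coord i xi, coord j xi).
have mpr : measurable_fun setT pr.
  by apply/measurable_fun_pairP; split; exact: measurable_coord.
pose prm : {mfun config V R >-> _} := HB.pack pr (isMeasurableFun.Build _ _ _ _ _ mpr).
pose mi := distribution mu (coord i); pose mj := distribution mu (coord j).
pose f (z : R * R) : \bar R := (z.1 * z.2)%:E.
have mf : measurable_fun setT f.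
  by apply/measurable_EFinP; apply: measurable_funM.
have prodE (X : set (R * R)) : measurable X -> (mi \x mj)%E X = distribution mu prm X.
  apply: product_measure_unique => A B mA mB.
  change (mu (pr @^-1` (A `*` B)) = (mu [set xi | A (xi i)] * mu [set xi | B (xi j)])%E).
  rewrite (_ : _ @^-1` _ = cylinder [:: i; j] (fun k => if k == i then A else B)).
    rewrite (iid_cylinder iid_mu i) /= ?inE ?ij//.
      rewrite big_cons big_seq1 eqxx eq_sym (negbTE ij).
      by rewrite (iid_marginal iid_mu i j mB).
    by move=> k; case: ifP.
  apply/seteqP; split=> xi /=.
    move=> [Ai Bj] k; rewrite !inE => /orP[] /eqP->; rewrite ?eqxx//.
    by rewrite eq_sym (negbTE ij).
  move=> h; split; first by have := h i; rewrite !inE eqxx; exact.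
  by have := h j; rewrite !inE eqxx orbT eq_sym (negbTE ij); exact.
have intf : (distribution mu prm).-integrable setT f.
  exact: integrable_pushforward.
have intf' : (mi \x mj)%E.-integrable setT f.
  apply/integrableP; split => //; case/integrableP: intf => _ h.
  by rewrite (eq_measure_integral (distribution mu prm))// => A mA _; exact: prodE.
rewrite /Rintegral.
have -> : (\int[mu]_xi (coord i xi * coord j xi)%:E = \int[mi \x mj]_z f z)%E.
  rewrite (eq_measure_integral (distribution mu prm)); last first.
    by move=> A mA _; exact: prodE.
  by rewrite integral_pushforward.
rewrite -integral12_prod_meas1//= /fubini_F /f/=.
have mj0' : (\int[mj]_y y%:E = 0)%E.
  rewrite /mj integral_pushforward//=.
  transitivity (\int[mu]_xi coord j xi)%:E; last by rewrite mj0.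
  exact/esym/fineK/integrable_fin_num.
under eq_integral => x _.
  under eq_integral do rewrite EFinM.
  rewrite integralZl//; last exact: integrable_pushforward.
  rewrite mj0' mule0.
  over.
by rewrite integral0.
Qed.

End IidMoments.

(** * Stabilization at critical density *)

Section IntegralGreen.
Context (V : eqType) (nb : V -> seq V) (R : realType).
Context d (T : measurableType d) (mu : probability T R).
Implicit Types (F : V -> T -> R).
Local Notation integrableR f := (mu.-integrable setT (EFin \o f)).

Lemma measurable_avg F x : (forall y, measurable_fun setT (F y)) ->
  measurable_fun setT (fun t => avg nb (F^~ t) x).
Proof.
by move=> mF; apply: measurable_funM; [exact: measurable_sum|exact: measurable_cst].
Qed.

Lemma integrableR_avg F x : (forall y, integrableR (F y)) ->
  integrableR (fun t => avg nb (F^~ t) x).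
Proof.
move=> iF; rewrite /avg; under eq_fun do rewrite mulrC.
by apply: integrableRZ; exact: integrableR_sum.
Qed.

Lemma Rintegral_avg F x : (forall y, integrableR (F y)) ->
  \int[mu]_t avg nb (F^~ t) x = avg nb (fun y => \int[mu]_t F y t) x.
Proof.
move=> iF; rewrite /avg RintegralZr//; last exact: integrableR_sum.
by rewrite Rintegral_sum.
Qed.

Lemma integrableR_green F m x : (forall y, integrableR (F y)) ->
  integrableR (fun t => green nb m (F^~ t) x).
Proof.
move=> iF; elim: m x => [|m IH] x /=; first exact: integrableR_cst.
by apply: integrableRD => //; exact: (@integrableR_avg (fun y t => green nb m (F^~ t) y)).
Qed.

Lemma Rintegral_green F m x : (forall y, integrableR (F y)) ->
  \int[mu]_t green nb m (F^~ t) x = green nb m (fun y => \int[mu]_t F y t) x.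
Proof.
move=> iF; elim: m x => [|m IH] x /=; first by rewrite Rintegral_prob_cst.
have ig y : integrableR (fun t => green nb m (F^~ t) y) by exact: integrableR_green.
rewrite RintegralD//; last exact: (integrableR_avg x ig).
congr (_ + _); rewrite (Rintegral_avg x ig).
by apply: eq_avg => y; exact: IH.
Qed.

End IntegralGreen.

(** * Stationarity and second moments of Green sums *)

Section CriticalSandpile.
Context (V : eqType) (nb : V -> seq V) (R : realType).
Hypothesis nbG : is_lf_graph nb.
Hypothesis connG : graph_connected nb.
Hypothesis infG : graph_infinite V.
Hypothesis transG : vertex_transitive nb.
Context (mu : probability (config V R) R).
Hypothesis iid_mu : iid_law mu.
Hypothesis sq_mu : forall x, mu.-integrable setT (EFin \o (fun xi => coord x xi ^+ 2)).
Hypothesis mean_mu : forall x, \int[mu]_xi coord x xi = 0.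
Implicit Types (xi : config V R) (x y z o : V).
Local Notation integrableR f := (mu.-integrable setT (EFin \o f)).

Lemma measurable_odo n x : measurable_fun setT (fun xi => odo nb xi n x).
Proof.
elim: n x => [|n IH] x /=; first exact: measurable_cst.
apply: measurable_maxr; first exact: measurable_cst.
apply: measurable_funD; first exact: measurable_coord.
exact: (@measurable_avg _ nb _ _ _ (fun y xi => odo nb xi n y)).
Qed.

Lemma measurable_defect n x : measurable_fun setT (fun xi => defect nb xi n x).
Proof.
apply: measurable_funB; last first.
  exact: (@measurable_avg _ nb _ _ _ (fun y xi => odo nb xi n y) x (measurable_odo n)).
by apply: measurable_funB; [exact: (measurable_odo n.+1)|exact: measurable_coord].
Qed.

Lemma integrable_coord x : integrableR (coord x).
Proof. by apply: integrableR_sqrt; [exact: measurable_coord|exact: sq_mu]. Qed.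

Lemma integrable_coordM x y : integrableR (fun xi => coord x xi * coord y xi).
Proof. by apply: integrableR_mul; [exact: measurable_coord..|exact: sq_mu|exact: sq_mu]. Qed.

Lemma Rintegral_reindex phi (f : config V R -> R) : bijective phi ->
  integrableR f -> \int[mu]_xi f (reindex phi xi) = \int[mu]_xi f xi.
Proof.
move=> bphi jf; have muE A : measurable A -> mu A = distribution mu (reindex phi) A.
  by move=> mA; exact: esym (iid_reindex iid_mu bphi mA).
have jf' : (distribution mu (reindex phi)).-integrable setT (EFin \o f).
  case/integrableP: jf => mf h; apply/integrableP; split=> //.
  by rewrite (eq_measure_integral mu)// => A mA _; exact/esym/muE.
have mf : measurable_fun setT (EFin \o f) by case/integrableP: jf.
have jc : mu.-integrable setT ((EFin \o f) \o reindex phi).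
  apply/integrableP; split; first exact: measurableT_comp mf (measurable_reindex _).
  case/integrableP: jf' => _; rewrite ge0_integral_pushforward//.
  exact: measurableT_comp.
rewrite [RHS]/Rintegral (eq_measure_integral (distribution mu (reindex phi))).
  by rewrite integral_pushforward.
by move=> A mA _; exact: muE.
Qed.

(** An automorphism carrying [x] to [y] preserves the law and turns [f x] into [f y]. *)
Lemma Rintegral_transitive (f : V -> config V R -> R) x y :
  (forall z, integrableR (f z)) ->
  (forall phi xi z, nb_equivariant nb phi ->
     f z (reindex phi xi) = f (phi z) xi) ->
  \int[mu]_xi f x xi = \int[mu]_xi f y xi.
Proof.
move=> jf fE; have [phi [aphi <-]] := transG x y.
rewrite -(Rintegral_reindex aphi.1 (jf x)).
by apply: eq_Rintegral => xi _; rewrite fE//; exact: perm_nb_automorphism.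
Qed.

Lemma second_moment x y : \int[mu]_xi (coord x xi ^+ 2) = \int[mu]_xi (coord y xi ^+ 2).
Proof. exact: (@Rintegral_transitive (fun z xi => coord z xi ^+ 2)). Qed.

Lemma second_moment_ge0 x : 0 <= \int[mu]_xi (coord x xi ^+ 2).
Proof. by apply: Rintegral_ge0 => xi _; exact: sqr_ge0. Qed.

Lemma covariance_coord o x y : \int[mu]_xi (coord x xi * coord y xi) =
  \int[mu]_xi (coord o xi ^+ 2) * point_mass R y x.
Proof.
rewrite /point_mass; have [->|xy] := eqVneq x y.
  by rewrite mulr1 (second_moment o y); under eq_Rintegral do rewrite -expr2.
rewrite mulr0; apply: iid_uncorrelated => //; first exact: integrable_coordM.
exact: integrable_coord.
Qed.

Lemma integrable_green_sqr m o : integrableR (fun xi => green nb m xi o ^+ 2).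
Proof.
under eq_fun do rewrite expr2 -greenZ.
apply: (@integrableR_green _ nb _ _ _ _ (fun y xi => green nb m xi o * xi y)) => y.
under eq_fun do rewrite mulrC -greenZ.
apply: (@integrableR_green _ nb _ _ _ _ (fun z xi => xi y * xi z)) => z.
exact: integrable_coordM.
Qed.

(** Linearity of [green] in each factor reduces the square to covariances, which are diagonal. What
    remains is a Green sum of Green function values, bounded by [green_point_mass_le]. *)
Lemma Rintegral_green_sqr_le N m o : \int[mu]_xi (green nb m xi o ^+ 2) <=
  m%:R * (\int[mu]_xi (coord o xi ^+ 2) *
          (m%:R / N.+1%:R + level_loss (size (nb o))%:R N)).
Proof.
set s2 := \int[mu]_xi (coord o xi ^+ 2).
have icov y z : integrableR (fun xi => xi y * xi z) by exact: integrable_coordM.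
have iG y : integrableR (fun xi => green nb m xi o * xi y).
  under eq_fun do rewrite mulrC -greenZ.
  exact: (@integrableR_green _ nb _ _ _ _ (fun z xi => xi y * xi z)).
under eq_Rintegral do rewrite expr2 -greenZ.
rewrite (@Rintegral_green _ nb _ _ _ _ (fun y xi => green nb m xi o * xi y))//.
rewrite -(green_cst nbG connG infG transG m _ o); apply: green_le => y _.
under eq_Rintegral do rewrite mulrC -greenZ.
rewrite (@Rintegral_green _ nb _ _ _ _ (fun z xi => xi y * xi z))//.
rewrite (@eq_green _ nb _ _ _ (fun z => s2 * point_mass R y z)); last first.
  move=> z; under eq_Rintegral do rewrite mulrC.
  exact: covariance_coord.
rewrite greenZ green_sym// ler_wpM2l ?second_moment_ge0//.
exact: green_point_mass_le.
Qed.

(** First [N] brings the coefficient of [n ^+ 2] below [e / 2]; then a large [n] absorbs the linear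
    term. *)
Lemma Rintegral_green_sqr_small (e : R) o : 0 < e -> exists n0, forall n, (n0 <= n)%N ->
  \int[mu]_xi (green nb n xi o ^+ 2) <= e * n%:R ^+ 2.
Proof.
move=> e0; set s2 := \int[mu]_xi (coord o xi ^+ 2).
have s20 : 0 <= s2 := second_moment_ge0 o.
pose N := Num.trunc (2 * s2 / e).
have hN : 2 * s2 / e < N.+1%:R by apply: truncnS_gt.
set l := level_loss ((size (nb o))%:R : R) N.
exists (Num.trunc (2 * s2 * l / e)).+1 => n hn.
have hn' : 2 * s2 * l / e < n%:R.
  by apply: lt_le_trans (truncnS_gt _) _; rewrite ler_nat.
apply: le_trans (Rintegral_green_sqr_le N n o) _; rewrite -/s2 -/l.
rewrite ltr_pdivrMr// in hn'; rewrite ltr_pdivrMr// in hN.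
have n0 : 0 <= n%:R :> R by [].
rewrite [leRHS](_ : _ = n%:R * (e * n%:R)); last by ring.
rewrite ler_wpM2l// mulrDr.
have -> : s2 * (n%:R / N.+1%:R) = s2 / N.+1%:R * n%:R by ring.
have h1 : s2 / N.+1%:R <= e / 2.
  by rewrite ler_pdivrMr// ltW//; lra.
have h2 : s2 / N.+1%:R * n%:R <= e / 2 * n%:R by rewrite ler_wpM2r.
have h3 : s2 * l <= e / 2 * n%:R by lra.
apply: le_trans (lerD h2 h3) _; lra.
Qed.

(** * The stabilization event and its invariance *)

Definition bounded_by (K : R) x : set (config V R) :=
  [set xi | forall n, odo nb xi n x <= K].

Definition stabilizable x : set (config V R) := \bigcup_k bounded_by k%:R x.

Lemma measurable_bounded_by K x : measurable (bounded_by K x).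
Proof.
rewrite (_ : bounded_by K x =
    \bigcap_n [set xi | odo nb xi n x <= K]); last first.
  by apply/seteqP; split=> xi h n; [move=> _; exact: h|exact: (h n I)].
apply: bigcapT_measurable => n; rewrite -[X in measurable X]setTI.
rewrite (_ : [set xi | _] = (fun xi => odo nb xi n x) @^-1` `]-oo, K]); last first.
  by apply/seteqP; split=> xi /=; rewrite in_itv/=.
by apply: measurable_odo => //; exact: measurable_itv.
Qed.

Lemma measurable_stabilizable x : measurable (stabilizable x).
Proof. by apply: bigcupT_measurable => k; exact: measurable_bounded_by. Qed.

Lemma stabilizableP x xi : stabilizable x xi <-> exists K, bounded_by K x xi.
Proof.
split=> [[k _ ?]|[K hK]]; first by exists k%:R.
exists (Num.trunc K).+1 => // n; apply: le_trans (hK n) _.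
exact/ltW/truncnS_gt.
Qed.

(** The average of [odo xi n] around [x] is at most [K - xi x], and its terms are nonnegative, so
    each is at most the degree times that. *)
Lemma stabilizable_adj x y xi : adj nb x y -> stabilizable x xi -> stabilizable y xi.
Proof.
move=> xy /stabilizableP[K hK]; apply/stabilizableP.
exists ((K - xi x) * (size (nb x))%:R) => n.
have := le_trans (odoS_ge nb xi n x) (hK n.+1).
rewrite -lerBrDl /avg ler_pdivrMr ?ltr0n ?nb_gt0//.
rewrite (perm_big _ (perm_to_rem xy))/= big_cons; apply: le_trans.
by rewrite lerDl; apply: sumr_ge0 => z _; exact: odo_ge0.
Qed.

Lemma stabilizable_any x y : stabilizable x = stabilizable y.
Proof.
suff sub u v : stabilizable u `<=` stabilizable v by apply/seteqP; split.
move=> xi; elim: (connG u v) => [a b|//|a b c _ ab _ bc sa].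
  exact: stabilizable_adj.
exact: bc (ab sa).
Qed.

Lemma stabilizable_reindex phi x xi : nb_equivariant nb phi ->
  stabilizable x (reindex phi xi) <-> stabilizable x xi.
Proof.
move=> aphi; rewrite [in X in _ <-> X](stabilizable_any x (phi x)).
have odoE n : odo nb (reindex phi xi) n x = odo nb xi n (phi x).
  exact: odo_automorphism.
by split=> -[k _ h]; exists k => // n; have := h n; rewrite odoE.
Qed.

Lemma integrable_odo n x : integrableR (fun xi => odo nb xi n x).
Proof.
apply: (@integrableR_le _ _ _ _ _ (fun xi => green nb n (fun y => `|xi y|) x)).
- exact: measurable_odo.
- apply: (@integrableR_green _ nb _ _ _ _ (fun y xi => `|xi y|)) => y.
  exact/integrableR_norm/integrable_coord.
- by move=> xi; rewrite ger0_norm ?odo_ge0//; exact: odo_green.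
Qed.

Lemma integrable_indic_stabilizable f o : integrableR f ->
  integrableR (fun xi => f xi * \1_(stabilizable o) xi).
Proof. by apply: integrableR_indic; exact: measurable_stabilizable. Qed.

Lemma indic_stabilizable_reindex o phi xi : nb_equivariant nb phi ->
  \1_(stabilizable o) (reindex phi xi) = \1_(stabilizable o) xi :> R.
Proof.
move=> aphi; rewrite !indicE; congr (_%:R); congr nat_of_bool.
by apply/idP/idP; rewrite !inE stabilizable_reindex.
Qed.

(** By invariance of the event this is a constant [c] over all sites, so the Green sum of length [n]
    has expectation [n * c] on it. As its second moment is [o(n^2)], [c = 0]. *)
Lemma Rintegral_coord_stabilizable o x :
  \int[mu]_xi (coord x xi * \1_(stabilizable o) xi) = 0.
Proof.
set c := LHS; set A := stabilizable o.
have ic y : integrableR (fun xi => coord y xi * \1_A xi).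
  exact/integrable_indic_stabilizable/integrable_coord.
have cE y : \int[mu]_xi (coord y xi * \1_A xi) = c.
  apply: (@Rintegral_transitive (fun z xi => coord z xi * \1_A xi)) => // phi xi z aphi.
  by rewrite indic_stabilizable_reindex.
have gE n : \int[mu]_xi (green nb n xi o * \1_A xi) = n%:R * c.
  under eq_Rintegral do rewrite mulrC -greenZ.
  rewrite (@Rintegral_green _ nb _ _ _ _ (fun y xi => \1_A xi * xi y)).
    rewrite -(green_cst nbG connG infG transG n _ o); apply: eq_green => y.
    by rewrite -[RHS](cE y); apply: eq_Rintegral => xi _; rewrite mulrC.
  by move=> y; have := ic y; under eq_fun do rewrite mulrC.
apply/eqP; rewrite -normr_le0; apply/ler_addgt0Pl => e e0; rewrite addr0.
have e2 : 0 < e / 2 by lra.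
have [n0 hn0] := @Rintegral_green_sqr_small ((e / 2) ^+ 2) o (exprn_gt0 _ e2).
pose n := n0.+1; have npos : 0 < n%:R :> R by rewrite ltr0n.
have := hn0 n (leqnSn _); set I2 := Rintegral _ _ _ => I2le.
(* With [b = e / 2 * n], this integrates [|g| <= b + g^2 / b]; since [I2 <= b^2], the bound is at
   most [2 * b = e * n]. *)
suff h : `|n%:R * c| <= e / 2 * n%:R + (e / 2 * n%:R)^-1 * I2.
  have e2n : 0 < e / 2 * n%:R by rewrite mulr_gt0.
  have : `|n%:R * c| <= e * n%:R.
    apply: le_trans h _; rewrite [leRHS](_ : _ = e / 2 * n%:R + e / 2 * n%:R).
      by rewrite lerD2l ler_pdivrMl// -expr2 exprMn.
    by lra.
  by rewrite normrM ger0_norm// mulrC ler_pM2r.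
rewrite -gE.
have iG : integrableR (fun xi => green nb n xi o).
  apply: (@integrableR_green _ nb _ _ _ _ (fun y xi => xi y)) => y.
  exact: integrable_coord.
have iGA : integrableR (fun xi => green nb n xi o * \1_A xi).
  exact: integrable_indic_stabilizable.
apply: le_trans (le_normr_Rintegral measurableT iGA) _.
have iG2 := integrable_green_sqr n o.
have e2n : 0 < e / 2 * n%:R by rewrite mulr_gt0.
have <- : \int[mu]_xi (e / 2 * n%:R + (e / 2 * n%:R)^-1 * green nb n xi o ^+ 2) =
    e / 2 * n%:R + (e / 2 * n%:R)^-1 * I2.
  rewrite RintegralD//; [|exact: integrableR_cst|exact: integrableRZ].
  by rewrite Rintegral_prob_cst RintegralZl.
apply: le_Rintegral => //.
- exact: integrableR_norm.
- by apply: integrableRD; [exact: integrableR_cst|exact: integrableRZ].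
move=> xi _; move: (e / 2 * n%:R) e2n => b b0.
apply: (@le_trans _ _ `|green nb n xi o|).
  by rewrite normrM indicE; case: (_ \in _); rewrite ?normr1 ?normr0 ?mulr1 ?mulr0.
rewrite -(real_normK (num_real (green nb n xi o))).
move: `|_| => a.
rewrite -(ler_pM2l b0) mulrDr mulrA mulfV ?gt_eqF// mul1r.
by have := sqr_ge0 (a - b); rewrite !expr2; nra.
Qed.

(** On the part of the event where [k] is exceeded, [odo] is at most the Green sum of [|xi|], and
    [a <= e * a^2 + e^-1] controls each term there. *)
Lemma Rintegral_odo_stabilizable_le (e : R) k n x : 0 < e ->
  \int[mu]_xi (odo nb xi n x * \1_(stabilizable x) xi) <=
  k%:R + n%:R * (e * \int[mu]_xi (coord x xi ^+ 2) +
    e^-1 * fine (mu (stabilizable x `\` bounded_by k%:R x))).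
Proof.
move=> e0; set s2 := Rintegral _ _ (fun xi => coord x xi ^+ 2).
set A := stabilizable x; set B := A `\` _.
have mB : measurable B.
  apply: measurableD; [exact: measurable_stabilizable|exact: measurable_bounded_by].
have inc y : integrableR (fun xi => `|xi y|).
  exact/integrableR_norm/integrable_coord.
have incB y : integrableR (fun xi => \1_B xi * `|xi y|).
  by have := integrableR_indic mB (inc y); under eq_fun do rewrite mulrC.
have iB : integrableR (\1_B : config V R -> R).
  by have := integrableR_indic mB (integrableR_cst mu 1); under eq_fun do rewrite mul1r.
have igB : integrableR (fun xi => green nb n (fun y => \1_B xi * `|xi y|) x).
  exact: (@integrableR_green _ nb _ _ _ _ (fun y xi => \1_B xi * `|xi y|)).
apply: (@le_trans _ _ (\int[mu]_xi (k%:R + green nb n (fun y => \1_B xi * `|xi y|) x))).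
  apply: le_Rintegral => //.
  - exact/integrable_indic_stabilizable/integrable_odo.
  - by apply: integrableRD => //; exact: integrableR_cst.
  move=> xi _; have g0 : 0 <= green nb n (fun y => \1_B xi * `|xi y|) x.
    by apply: green_ge0 => y; rewrite mulr_ge0// indicE ler0n.
  have [xiA|xiA] := pselect (A xi); last first.
    by rewrite indicE memNset// mulr0 addr_ge0.
  rewrite [X in _ * X]indicE mem_set// mulr1.
  have [xik|xik] := pselect (bounded_by k%:R x xi).
    by apply: le_trans (xik n) _; rewrite lerDl.
  rewrite greenZ indicE mem_set// mul1r; apply: le_trans (odo_green _ _ _ _) _.
  by rewrite lerDr.
rewrite RintegralD//; last exact: integrableR_cst.
rewrite Rintegral_prob_cst lerD2l.
rewrite (@Rintegral_green _ nb _ _ _ _ (fun y xi => \1_B xi * `|xi y|))//.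
rewrite -(green_cst nbG connG infG transG n _ x); apply: green_le => y _.
have -> : e * s2 + e^-1 * fine (mu B) =
    \int[mu]_xi (e * coord y xi ^+ 2 + e^-1 * \1_B xi).
  rewrite RintegralD//; [|exact: integrableRZ (sq_mu y)|exact: integrableRZ].
  by rewrite RintegralZl// RintegralZl// Rintegral_indic// -(second_moment x y).
apply: le_Rintegral => //.
  by apply: integrableRD; [exact: integrableRZ (sq_mu y)|exact: integrableRZ].
move=> xi _; rewrite /coord -(real_normK (num_real (xi y))) indicE.
have := normr_ge0 (xi y); move: `|xi y| => a a0.
case: (_ \in _); rewrite ?mul0r ?mul1r ?mulr0 ?addr0 ?mulr1.
  rewrite -(ler_pM2l e0) mulrDr mulfV ?gt_eqF//.
  by have := sqr_ge0 (e * a - 1); have := sqr_ge0 (e * a); rewrite !expr2; nra.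
by rewrite mulr_ge0 ?sqr_ge0// ltW.
Qed.

(** Defects decrease in [n], so here the limit [f] of the iterates exists and exceeds [xi + avg f]
    at [x] by at least [dl]. *)
Definition stuck (dl : R) x : set (config V R) :=
  stabilizable x `&` [set xi | forall n, dl <= defect nb xi n x].

Lemma measurable_stuck dl x : measurable (stuck dl x).
Proof.
apply: measurableI; first exact: measurable_stabilizable.
rewrite (_ : [set xi | _] = \bigcap_n [set xi | dl <= defect nb xi n x]); last first.
  by apply/seteqP; split=> xi h n; [move=> _; exact: h|exact: (h n I)].
apply: bigcapT_measurable => n; rewrite -[X in measurable X]setTI.
rewrite (_ : [set xi | _] = (fun xi => defect nb xi n x) @^-1` `[dl, +oo[); last first.
  by apply/seteqP; split=> xi /=; rewrite in_itv/= andbT.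
by apply: measurable_defect => //; exact: measurable_itv.
Qed.

(* Mass is conserved: the expectation of [odo xi n x] on the invariant event
   [stabilizable x] grows by at least [dl * mu (stuck dl x)] with each step,
   but it is [o(n)] since [odo xi n x] is bounded in [n] there. *)
Lemma mu_stuck dl x : 0 < dl -> mu (stuck dl x) = 0%E.
Proof.
move=> dl0; set A := stabilizable x; set p := fine (mu (stuck dl x)).
set s2 := \int[mu]_xi (coord x xi ^+ 2).
have s20 : 0 <= s2 := second_moment_ge0 x.
have mS := measurable_stuck dl x.
have iA f : integrableR f -> integrableR (fun xi => f xi * \1_A xi).
  exact: integrable_indic_stabilizable.
pose a n y := \int[mu]_xi (odo nb xi n y * \1_A xi).
have aE n y : a n y = a n x.
  apply: (@Rintegral_transitive (fun z xi => odo nb xi n z * \1_A xi)).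
    by move=> z; exact/iA/integrable_odo.
  move=> phi xi z aphi; rewrite indic_stabilizable_reindex//; congr (_ * _).
  exact: odo_automorphism.
(* Of the three terms of [odo xi n.+1], [xi] has expectation zero on the event, the average keeps
   the expectation [a n x] by stationarity, and the defect is at least [dl] on [stuck dl x]. *)
have step n : a n x + dl * p <= a n.+1 x.
  have iavg : integrableR (fun xi => avg nb (fun y => \1_A xi * odo nb xi n y) x).
    apply: (@integrableR_avg _ nb _ _ _ _ (fun y xi => \1_A xi * odo nb xi n y)) => y.
    by have := iA _ (integrable_odo n y); under eq_fun do rewrite mulrC.
  have icA := iA _ (integrable_coord x).
  have iS : integrableR (\1_(stuck dl x) : config V R -> R).
    by have := integrableR_indic mS (integrableR_cst mu 1); under eq_fun do rewrite mul1r.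
  have -> : a n x + dl * p = \int[mu]_xi (coord x xi * \1_A xi +
      avg nb (fun y => \1_A xi * odo nb xi n y) x + dl * \1_(stuck dl x) xi).
    rewrite RintegralD//; [|exact: integrableRD|exact: integrableRZ].
    rewrite RintegralD// Rintegral_coord_stabilizable add0r RintegralcM_indic//.
    congr (_ + _).
    rewrite (@Rintegral_avg _ nb _ _ _ _ (fun y xi => \1_A xi * odo nb xi n y)).
      rewrite -[LHS](avg_cst nbG connG infG transG (a n x) x); apply: eq_avg => y.
      by rewrite -(aE n y); apply: eq_Rintegral => xi _; rewrite mulrC.
    by move=> y; have := iA _ (integrable_odo n y); under eq_fun do rewrite mulrC.
  apply: le_Rintegral => //.
  - by apply: integrableRD; [exact: integrableRD|exact: integrableRZ].
  - exact/iA/integrable_odo.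
  move=> xi _; rewrite avgZ.
  have dE : odo nb xi n.+1 x = xi x + avg nb (odo nb xi n) x + defect nb xi n x.
    by rewrite /defect; ring.
  have [xiS|xiS] := pselect (stuck dl x xi).
    rewrite [X in dl * X]indicE mem_set// indicE mem_set; last by case: xiS.
    by rewrite dE /coord !mulr1 mul1r lerD2l; case: xiS.
  rewrite [X in dl * X]indicE memNset// mulr0 addr0 dE indicE.
  case: (_ \in _); rewrite ?mulr0 ?mul0r ?addr0// !mulr1 mul1r /coord lerDl.
  exact: defect_ge0.
have lin n : n%:R * (dl * p) <= a n x.
  elim: n => [|n IH]; last by apply: le_trans (step n); rewrite -natr1 mulrDl mul1r lerD2r.
  by rewrite mul0r; apply: Rintegral_ge0 => xi _; rewrite mul0r.
suff p0 : dl * p <= 0.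
  apply/eqP; rewrite -[X in X == _]fineK ?fin_num_measure// -/p eqe eq_le.
  by rewrite fine_ge0// andbT -(pmulr_rle0 _ dl0).
apply/ler_addgt0Pl => e e0; rewrite addr0.
(* After division by [n] the errors are [k / n], [e1 * s2] and [e1^-1] times a tail measure of at
   most [e1 ^+ 2]; they add up to at most [e1 * (s2 + 2)]. *)
pose e1 := e / (s2 + 2).
have e10 : 0 < e1 by rewrite divr_gt0//; lra.
have ndA : nondecreasing_seq (fun k => bounded_by k%:R x).
  move=> i j ij; apply/subsetPset => xi h n; apply: le_trans (h n) _.
  by rewrite ler_nat.
have [k hk] := mu_bigcup_tail mu (exprn_gt0 2 e10)
  (fun k => measurable_bounded_by k%:R x) ndA.
pose n := (Num.trunc (k%:R / e1)).+1.
have hn : k%:R < e1 * n%:R.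
  by rewrite mulrC -ltr_pdivrMr//; exact: truncnS_gt.
have := le_trans (lin n) (@Rintegral_odo_stabilizable_le e1 k n x e10).
rewrite -/s2; set q := fine _ => hq.
have hq1 : e1^-1 * q <= e1 by rewrite ler_pdivrMl// -expr2.
have eE : e = e1 * (s2 + 2) by rewrite /e1 divfK// gt_eqF//; lra.
have npos : 0 < n%:R :> R by rewrite ltr0n.
rewrite -(ler_pM2l npos); apply: (le_trans hq); rewrite eE.
have : n%:R * (e1 * s2 + e1^-1 * q) <= n%:R * (e1 * s2 + e1).
  by rewrite ler_pM2l// lerD2l.
by move: (n%:R * (e1 * s2 + _ * q)) => z; nra.
Qed.

(** On the event [C] that [xi <= b] on [F], overwriting raises the configuration, so if the result
    is stuck, then so is [xi]. By independence the product of the probability in question with that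
    of [C], which is positive, is thus zero. *)
Lemma mu_overwrite_stuck (dl b : R) (F : seq V) o x : 0 < dl ->
  (0 < mu [set xi | (xi o <= b)%R])%E ->
  mu (overwrite F b @^-1` stuck dl x) = 0%E.
Proof.
move=> dl0 b0; have mS := measurable_stuck dl x.
pose Ib := [set` `]-oo, b]%R] : set R.
have mb : measurable Ib by exact: measurable_itv.
set C := cylinder F (fun=> Ib).
have mE : measurable (overwrite F b @^-1` stuck dl x).
  by rewrite -[X in measurable X]setTI; exact: measurable_overwrite.
have mC : measurable (C : set (config V R)) by exact: measurable_cylinder.
have C0 : (0 < mu C)%E.
  apply: (iid_cylinder_gt0 iid_mu F mb (i0 := o)).
  suff -> : [set xi : config V R | Ib (xi o)] = [set xi | xi o <= b] by exact: b0.
  by apply/seteqP; split=> xi /=; rewrite /Ib/= in_itv.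
have sub : overwrite F b @^-1` stuck dl x `&` C `<=` stuck dl x.
  move=> xi [[[k _ hk] hd] xiC].
  have le y : xi y <= overwrite F b xi y.
    rewrite /overwrite; case: ifPn => // yF.
    by have := xiC y yF; rewrite /Ib/= in_itv.
  split; first by exists k => // n; apply: le_trans (hk n); exact: odo_le.
  by move=> n; apply: le_trans (hd n) _; exact: defect_anti.
have : (mu C * mu (overwrite F b @^-1` stuck dl x) = 0)%E.
  rewrite -(iid_overwrite iid_mu F b (fun=> mb) mS).
  apply/eqP; rewrite eq_le measure_ge0 andbT -(mu_stuck x dl0).
  by apply: le_measure => //; rewrite inE//; exact: measurableI.
by move/eqP; rewrite mule_eq0 (gt_eqF C0)/= => /eqP.
Qed.

(* Overwriting [xi] by [- e] wherever it exceeds [- e] on [ball m o] lowers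
   [odo] at [o] by at least [green m (xi + e)] minus the defects of the new
   configuration. *)
Lemma bounded_by_green (e : R) K m o xi : 0 < e -> bounded_by K o xi ->
  (forall bs i, ~ stuck (e / 2) (nth o (ball nb m o) i)
     (overwrite (mask bs (ball nb m o)) (- e) xi)) ->
  green nb m xi o + m%:R * (e / 2) <= K.
Proof.
move=> e0 hK nstuck; pose F := [seq y <- ball nb m o | - e <= xi y].
pose xi' := overwrite F (- e) xi.
have le y : xi' y <= xi y.
  by rewrite /xi' /overwrite mem_filter; case: ifPn => // /andP[].
have stab y : stabilizable y xi'.
  rewrite (stabilizable_any y o); apply/stabilizableP; exists K => n.
  by apply: le_trans (hK n); exact: odo_le.
have small y : y \in ball nb m o -> exists n, defect nb xi' n y < e / 2.
  move=> yb; apply: contrapT => nosmall.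
  (* The list [F] depends on [xi]; as a mask of the fixed list [ball nb m o] it is one of countably
     many deterministic lists. *)
  apply: (nstuck [seq - e <= xi z | z <- ball nb m o] (index y (ball nb m o))).
  rewrite -filter_mask nth_index// -/F -/xi'; split=> // n; rewrite leNgt.
  by apply/negP => h; apply: nosmall; exists n.
(* Defects decrease in [n], so the largest of the individual times serves the whole ball. *)
have [n hn] : exists n, forall y, y \in ball nb m o -> defect nb xi' n y < e / 2.
  elim: (ball nb m o) small => [|y r IH] small; first by exists 0%N.
  have [|n1 h1] := small y; first by rewrite inE eqxx.
  have [z zr|n2 h2] := IH; first by apply: small; rewrite inE zr orbT.
  exists (maxn n1 n2) => z; rewrite inE => /predU1P[->|zr].
    by apply: le_lt_trans h1; apply: defect_anti => //; exact: leq_maxl.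
  by apply: le_lt_trans (h2 z zr); apply: defect_anti => //; exact: leq_maxr.
have gap := odo_gap nb n m o le.
have gK : odo nb xi (n + m) o - odo nb xi' (n + m) o <= K.
  by rewrite lerBlDr; apply: ler_wpDr; [exact: odo_ge0|exact: hK].
rewrite -(green_cst nbG connG infG transG m (e / 2) o) -greenD.
apply: le_trans (le_trans gap gK); apply: green_le => y yb; have := hn y yb.
have -> : xi' y = if - e <= xi y then - e else xi y.
  by rewrite /xi' /overwrite mem_filter yb andbT.
(* Where [xi] was lowered, the gain [xi + e] loses less than [e / 2] to the defect; elsewhere
   [xi + e / 2 < - e / 2], which is below minus the defect. *)
by case: ifPn => [_|]; rewrite -?ltNge; lra.
Qed.

(** Outside a null set the bound [K] forces the Green sum at [o] below [- m * e / 4] once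
    [m * e > 4 * K]. By Chebyshev's inequality this has small probability for large [m], the second
    moment being [o(m^2)]. *)
Lemma mu_bounded_by (e K : R) o : 0 < e -> (0 < mu [set xi | (xi o <= - e)%R])%E ->
  mu (bounded_by K o) = 0%E.
Proof.
move=> e0 pe; have e20 : 0 < e / 2 by lra.
have mK := measurable_bounded_by K o.
suff p0 : fine (mu (bounded_by K o)) <= 0.
  apply/eqP; rewrite -[X in X == _]fineK ?fin_num_measure// eqe eq_le p0.
  by rewrite fine_ge0.
apply/ler_addgt0Pl => th th0; rewrite addr0.
have th' : 0 < th * (e / 4) ^+ 2 by rewrite mulr_gt0// exprn_gt0//; lra.
have [n0 hn0] := Rintegral_green_sqr_small o th'.
pose m := (n0 + (Num.trunc (4 * K / e)).+1)%N.
have mpos : 0 < m%:R :> R by rewrite ltr0n /m addnS.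
have mK4 : 4 * K < m%:R * e.
  rewrite -ltr_pdivrMr//; apply: lt_le_trans (truncnS_gt _) _.
  by rewrite ler_nat leq_addl.
have I2 := hn0 m (leq_addr _ _).
pose S := [set xi : config V R | green nb m xi o <= - (m%:R * (e / 4))].
have mG : measurable_fun setT (fun xi : config V R => green nb m xi o).
  apply: integrableR_measurable.
  apply: (@integrableR_green _ nb _ _ _ _ (fun y xi => xi y)) => y.
  exact: integrable_coord.
have mS : measurable S.
  rewrite -[X in measurable X]setTI (_ : S = (fun xi : config V R => green nb m xi o)
      @^-1` `]-oo, (- (m%:R * (e / 4)))]); first by apply: mG => //; exact: measurable_itv.
  by apply/seteqP; split=> xi /=; rewrite in_itv.
(* [pickle] enumerates masks and indices, so the exceptional events form one countable union. *)
pose bad := \bigcup_k if unpickle k is Some (bs, i) then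
    overwrite (mask bs (ball nb m o)) (- e) @^-1`
      stuck (e / 2) (nth o (ball nb m o) i)
  else set0 : set (config V R).
have nbad : mu.-negligible bad.
  apply: negligible_bigcup => k; case: unpickle => [[bs i]|]; last exact: negligible_set0.
  exists (overwrite (mask bs (ball nb m o)) (- e) @^-1`
    stuck (e / 2) (nth o (ball nb m o) i)); split=> //; last exact: mu_overwrite_stuck pe.
  rewrite -[X in measurable X]setTI; apply: measurable_overwrite => //.
  exact: measurable_stuck.
have sub : bounded_by K o `<=` bad `|` S.
  move=> xi hK; have [|nb_xi] := pselect (bad xi); [by left|right].
  have := @bounded_by_green e K m o xi e0 hK.
  rewrite /S/= => h; have {}h : green nb m xi o + m%:R * (e / 2) <= K.
    apply: h => bs i hs; apply: nb_xi; exists (pickle (bs, i)) => //.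
    by rewrite pickleK.
  by lra.
have [N [mN N0 badN]] := nbad.
have : fine (mu (bounded_by K o)) <= fine (mu S).
  rewrite fine_le ?fin_num_measure//.
  apply: (@le_trans _ _ (mu (N `|` S))).
    apply: le_measure; rewrite ?inE//; first exact: measurableU.
    by move=> xi /sub[/badN|]; [left|right].
  apply: le_trans (measureU2 _ _ _) _ => //.
  by rewrite [X in (X + _)%E]N0 add0e.
move=> /le_trans; apply.
have iS2 : integrableR (\1_S : config V R -> R).
  by have := integrableR_indic mS (integrableR_cst mu 1); under eq_fun do rewrite mul1r.
have b0 : 0 < m%:R * (e / 4) by rewrite mulr_gt0//; lra.
rewrite -(Rintegral_indic mu mS).
rewrite -(ler_pM2l (exprn_gt0 2 b0)) -RintegralZl//.
apply: (@le_trans _ _ (\int[mu]_xi (green nb m xi o ^+ 2))); last first.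
  by apply: (le_trans I2); rewrite exprMn; lra.
apply: le_Rintegral => //; [exact: integrableRZ|exact: integrable_green_sqr|].
move=> xi _; rewrite indicE; case: (boolP (_ \in _)) => [|_]; last by rewrite mulr0 sqr_ge0.
rewrite inE /S/= mulr1; move: (m%:R * (e / 4)) b0 (green nb m xi o) => b b0 g gb.
by rewrite -[g ^+ 2]sqrrN ler_sqr ?nnegrE; lra.
Qed.

Lemma mu_stabilizable o : 0 < \int[mu]_xi (coord o xi ^+ 2) ->
  mu (stabilizable o) = 0%E.
Proof.
move=> s20; have [e e0 pe] := neg_level_gt0 (integrable_coord o) (mean_mu o) s20.
apply/negligibleP; first exact: measurable_stabilizable.
apply: negligible_bigcup => k; apply/negligibleP; first exact: measurable_bounded_by.
exact: mu_bounded_by pe.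
Qed.

End CriticalSandpile.

(** * From stabilizing functions to bounded iterates *)

Section Stabilization.
Context (V : eqType) (nb : V -> seq V) (R : realType).
Hypothesis nbG : is_lf_graph nb.
Hypothesis connG : graph_connected nb.
Hypothesis infG : graph_infinite V.
Hypothesis transG : vertex_transitive nb.

(** Dividing [s + laplacian f <= 1] by the degree gives [xi + avg f <= f], so [f o] bounds every
    iterate at [o]. *)
Lemma stabilizes_stabilizable (s : V -> R) o : stabilizes nb s ->
  stabilizable nb o (fun x => (size (nb o))%:R^-1 * (s x - 1)).
Proof.
move=> [f [f0 sf]]; apply/stabilizableP; exists (f o) => n; apply: odo_least => // x.
have D0 y : 0 < (size (nb y))%:R :> R by rewrite ltr0n nb_gt0.
rewrite (size_nb nbG transG o x) /avg [_^-1 * _]mulrC -mulrDl ler_pdivrMr//.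
have := sf x; rewrite /laplacian big_split/= sumrN big_const_seq count_predT.
by rewrite iter_addr addr0 -mulr_natr; lra.
Qed.

End Stabilization.

Theorem theorem1p1 (V : eqType) (nb : V -> seq V)
  (R : realType) (d : measure_display) (T : measurableType d)
  (P : probability T R) (s : V -> {RV P >-> R}) :
  is_lf_graph nb -> graph_connected nb -> graph_infinite V ->
  vertex_transitive nb ->
  mutually_independent P (fun x => (s x : T -> R)) ->
  identically_distributed P (fun x => (s x : T -> R)) ->
  (forall x, (s x : T -> R) \in Lfun P 1%:E) ->
  (forall x, ('E_P[s x] = 1)%E) ->
  (forall x, (s x : T -> R) \in Lfun P 2%:E) ->
  (forall x, (0 < 'V_P[s x])%E /\ ('V_P[s x] < +oo)%E) ->
  {ae P, forall w, ~ stabilizes nb (fun x => s x w)}.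
Proof.
move=> nbG connG infG transG indep ident L1 mean1 L2 var_s.
have [ o _] : exists o : V, True.
  apply: contrapT => noV; apply: infG; exists [::] => x.
  by case: noV; exists x.
pose c : R := (size (nb o))%:R^-1.
have c0 : 0 < c by rewrite invr_gt0 ltr0n (nb_gt0 nbG connG infG transG).
pose h (r : R) := c * (r - 1).
have mh : measurable_fun setT h.
  by apply: measurable_funM => //; exact: measurable_funB.
pose X (w : T) : config V R := fun x => h (s x w).
have mX : measurable_fun setT X.
  by apply: measurable_to_config => x; exact: measurableT_comp.
pose Xm : {mfun T >-> config V R} := HB.pack X (isMeasurableFun.Build _ _ _ _ _ mX).
pose mu := distribution P Xm.
have iidX : iid_law mu.
  exists (fun B => P (s o @^-1` (h @^-1` B))) => J B uJ mB.
  have mhB i : measurable (h @^-1` B i).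
    by rewrite -[X in measurable X]setTI; exact: mh.
  transitivity (P (\bigcap_(i in [set` J]) (s i @^-1` (h @^-1` B i)))).
    by congr (P _); apply/seteqP; split.
  rewrite (indep J (fun i => h @^-1` B i))//.
  by apply: eq_bigr => i _; exact: (ident i o (h @^-1` B i)).
have iS x : P.-integrable setT (EFin \o s x) by exact/Lfun1_integrable.
have iS2 x : P.-integrable setT (EFin \o (fun w => s x w ^+ 2)).
  exact: Lfun2_integrable_sqr.
have iX x : P.-integrable setT (EFin \o (fun w => X w x)).
  apply: integrableRZ; apply: integrableRD => //; exact: integrableR_cst.
have iV x : P.-integrable setT (EFin \o (fun w => (s x w - 1) ^+ 2)).
  rewrite (_ : (fun w => (s x w - 1) ^+ 2) =
    (fun w => s x w ^+ 2 + (- 2 * s x w + 1))); last first.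
    by apply/funext => w; ring.
  apply: integrableRD => //; apply: integrableRD; last exact: integrableR_cst.
  exact: integrableRZ.
have iX2 x : P.-integrable setT (EFin \o (fun w => X w x ^+ 2)).
  rewrite /X /h; under eq_fun do rewrite exprMn.
  exact: integrableRZ.
have RE (f : R -> R) x : measurable_fun setT f ->
    P.-integrable setT (EFin \o (fun w => f (X w x))) ->
    \int[mu]_xi f (coord x xi) = \int[P]_w f (X w x).
  move=> mf jf; rewrite /Rintegral integral_pushforward//.
  by apply/measurable_EFinP; apply: measurableT_comp => //; exact: measurable_coord.
have sq_mu x : mu.-integrable setT (EFin \o (fun xi => coord x xi ^+ 2)).
  apply: integrable_pushforward => //; last exact: iX2.
  by apply/measurable_EFinP; apply: measurable_funX; exact: measurable_coord.
have mean_mu x : \int[mu]_xi coord x xi = 0.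
  rewrite (RE id)//; rewrite /X /h RintegralZl//; last first.
    by apply: integrableRD => //; exact: integrableR_cst.
  rewrite RintegralB//; last exact: integrableR_cst.
  rewrite Rintegral_prob_cst; have := mean1 x; rewrite unlock => mean1x.
  by rewrite /Rintegral mean1x/= subrr mulr0.
(* This second moment is [c ^+ 2] times the variance of [s o], whose mean is 1. *)
have var_mu : 0 < \int[mu]_xi (coord o xi ^+ 2).
  rewrite (RE (fun r => r ^+ 2))//; rewrite /X /h.
  under eq_Rintegral do rewrite exprMn.
  rewrite RintegralZl; [|by []|exact: iV].
  rewrite mulr_gt0 ?exprn_gt0// -lte_fin.
  have [v0 _] := var_s o; apply: (lt_le_trans v0).
  rewrite /variance unlock mean1 unlock /= /Rintegral fineK; first exact: lexx.
  exact: (integrable_fin_num measurableT (iV o)).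
have mu0 : mu (stabilizable nb o) = 0%E by exact: mu_stabilizable.
(* The stabilizing outcomes are only shown to lie in this measurable null event, as an almost sure
   statement asks. *)
exists (X @^-1` stabilizable nb o); split=> //.
  rewrite -[X in measurable X]setTI; apply: (mX measurableT).
  exact: measurable_stabilizable.
move=> w /= /contrapT stab; exact: stabilizes_stabilizable stab.
Qed.
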